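(* Let a pHDAE in block form $$E\dot x=(J-R)Qx+Bu,\qquad y=B^TQx$$ be given, with state $x=[x_1^T\ x_2^T\ x_3^T]^T$, $x_i\in\mathbb R^{n_i}$, $n=n_1+n_2+n_3$, structured as described in the context, and let $Q_{11}=KK^T$ be a Cholesky factorization of its energy matrix block $Q_{11}$. Let $s_0\in\mathbb C\cup\{\infty\}$ be a shift parameter, let $r<n_1$ (in applications $r\ll n_1$), and let $V_r\in\mathbb R^{n_1\times r}$ be a projection matrix computed by the Arnoldi method for $s_0$ (in the sense described in the context). Put $L_{ij}=J_{ij}-R_{ij}$. Then the reduced system, for the state $x^{\mathrm m}=[x_{1,r}^T\ x_2^T\ x_3^T]^T\in\mathbb R^{r+n_2+n_3}$ with $x_{1,r}=V_r^TK^Tx_1$, is given by $$E^{\mathrm m}\dot x^{\mathrm m}=(J^{\mathrm m}-R^{\mathrm m})Q^{\mathrm m}x^{\mathrm m}+B^{\mathrm m}u,\qquad y^{\mathrm m}=(B^{\mathrm m})^TQ^{\mathrm m}x^{\mathrm m},$$ with $$E^{\mathrm m}=\begin{bmatrix}I_r&0&0\\ 0&I_{n_2}&0\\ 0&0&0\end{bmatrix},\qquad J^{\mathrm m}-R^{\mathrm m}=\begin{bmatrix}V_r^TK^TL_{11}KV_r&V_r^TK^TL_{12}&V_r^TK^TL_{13}\\ L_{21}KV_r&L_{22}&L_{23}\\ L_{31}KV_r&L_{32}&L_{33}\end{bmatrix},$$ $$Q^{\mathrm m}=\begin{bmatrix}I_r&0&0\\ 0&0&0\\ Q_{31}K^{-T}V_r&Q_{32}&Q_{33}\end{bmatrix},\qquad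 B^{\mathrm m}=\begin{bmatrix}V_r^TK^TB_1\\ B_2\\ B_3\end{bmatrix};$$ it is port-Hamiltonian (i.e. a pHDAE), and it matches the first $r$ moments at $s_0$ of the full order system.
   Context: **pHDAE.** A system $E\dot x=(J-R)Qx+(B-P)u$, $y=(B+P)^TQx+(S+N)u$ with real matrices $E,Q,J,R\in\mathbb R^{n\times n}$, $B,P\in\mathbb R^{n\times m}$, $S=S^T,N=-N^T\in\mathbb R^{m\times m}$ is called a port-Hamiltonian differential-algebraic system (pHDAE) if: (1) $Q^TJ^TQ=-Q^TJQ$ and $Q^TE=E^TQ$; (2) $Q^TE=E^TQ\ge0$ (positive semidefinite); (3) the passivity matrix $W=\begin{bmatrix}Q^TRQ&Q^TP\\ P^TQ&S\end{bmatrix}$ satisfies $W=W^T\ge0$. When $P=S=N=0$, condition (3) says $Q^TRQ=Q^TR^TQ\ge 0$. **Block form of the full system.** Here $P=S=N=0$, and with respect to $\mathbb R^n=\mathbb R^{n_1}\times\mathbb R^{n_2}\times\mathbb R^{n_3}$, $$E=\begin{bmatrix}I_{n_1}&0&0\\ 0&I_{n_2}&0\\ 0&0&0\end{bmatrix},\quad Q=\begin{bmatrix}Q_{11}&0&0\\ 0&0&0\\ Q_{31}&Q_{32}&Q_{33}\end{bmatrix},\quad J=[J_{ij}],\quad R=[R_{ij}]=R^T,\quad B=\begin{bmatrix}B_1\\ B_2\\ B_3\end{bmatrix}\in\mathbb R^{n\times m},$$ the system is a pHDAE, $J_{j3}-R_{j3}=0$ for $j=1,2$, $Q_{11}=Q_{11}^T>0$,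 $Q_{33}$ is nonsingular, and the pencil $sE-(J-R)Q$ is regular (its determinant is not identically zero in $s\in\mathbb C$). **Reduced system.** Put $U=\mathrm{diag}(K,I_{n_2},I_{n_3})$ and $V_r^{\mathrm m}=\mathrm{diag}(V_r,I_{n_2},I_{n_3})\in\mathbb R^{n\times(r+n_2+n_3)}$. The full system is first transformed to the system with state $U^Tx$ and matrices $U^TEU^{-T}=E$, $U^TJU$, $U^TRU$, $U^{-1}QU^{-T}$, $U^TB$; the reduced system is obtained by the Galerkin projection with $V_r^{\mathrm m}$, i.e. its matrices are $E^{\mathrm m}=(V_r^{\mathrm m})^TEV_r^{\mathrm m}$, $J^{\mathrm m}=(V_r^{\mathrm m})^TU^TJUV_r^{\mathrm m}$, $R^{\mathrm m}=(V_r^{\mathrm m})^TU^TRUV_r^{\mathrm m}$, $Q^{\mathrm m}=(V_r^{\mathrm m})^TU^{-1}QU^{-T}V_r^{\mathrm m}$, $B^{\mathrm m}=(V_r^{\mathrm m})^TU^TB$. **Projection matrix computed by the Arnoldi method.** This means: $V_r^TV_r=I_r$ and the columns of $V_r$ span (over $\mathbb C$) the order-$r$ Krylov space of the dynamic part of the transformed system associated with $s_0$. With $A=K^T(J_{11}-R_{11})K$ and $b=K^TB_1$, this is the span of the columns of $(s_0I-A)^{-1}b,(s_0I-A)^{-2}b,\dots,(s_0I-A)^{-r}b$ if $s_0\in\mathbb C$, and of $b,Ab,\dots,A^{r-1}b$ if $s_0=\infty$. **Moments.** The transfer function of the full system is $G(s)=B^TQ(sE-(J-R)Q)^{-1}B$,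 and that of the reduced system is $G^{\mathrm m}(s)=(B^{\mathrm m})^TQ^{\mathrm m}(sE^{\mathrm m}-(J^{\mathrm m}-R^{\mathrm m})Q^{\mathrm m})^{-1}B^{\mathrm m}$. For $s_0\in\mathbb C$ it is understood that $s_0E-(J-R)Q$ and $s_0E^{\mathrm m}-(J^{\mathrm m}-R^{\mathrm m})Q^{\mathrm m}$ are nonsingular, and the moments $m_j$ at $s_0$ are the coefficients in $G(s)=\sum_{j\ge0}m_j(s_0-s)^j$ near $s_0$ (likewise for $G^{\mathrm m}$). For $s_0=\infty$ the moments are the Markov parameters, i.e. $m_j$ ($j\ge0$) is the coefficient of $s^{-(j+1)}$ in the Laurent expansion at $s=\infty$. ''Matches the first $r$ moments at $s_0$'' means that $m_0,\dots,m_{r-1}$ coincide for $G$ and $G^{\mathrm m}$. *)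

(* Defs.v *)
From mathcomp Require Export all_boot all_order all_algebra.
From mathcomp Require Export complex.
From mathcomp Require Export all_classical all_reals all_analysis.
Export Order.TTheory GRing.Theory Num.Theory numFieldNormedType.Exports.

Set Implicit Arguments.
Unset Strict Implicit.
Unset Printing Implicit Defensive.

#[export] Set Implicit Arguments.
#[export] Unset Strict Implicit.
#[export] Unset Printing Implicit Defensive.

Local Open Scope classical_set_scope.
Local Open Scope ring_scope.

(* 3 x 3 block matrices; dimensions are bracketed as a + (b + c). *)
Definition block3 (T : Type) (a1 a2 a3 b1 b2 b3 : nat)
    (M11 : 'M[T]_(a1, b1)) (M12 : 'M[T]_(a1, b2)) (M13 : 'M[T]_(a1, b3))
    (M21 : 'M[T]_(a2, b1)) (M22 : 'M[T]_(a2, b2)) (M23 : 'M[T]_(a2, b3))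
    (M31 : 'M[T]_(a3, b1)) (M32 : 'M[T]_(a3, b2)) (M33 : 'M[T]_(a3, b3)) :
    'M[T]_(a1 + (a2 + a3), b1 + (b2 + b3)) :=
  block_mx M11 (row_mx M12 M13)
           (col_mx M21 M31) (block_mx M22 M23 M32 M33).

Definition col3 (T : Type) (a1 a2 a3 b : nat)
    (M1 : 'M[T]_(a1, b)) (M2 : 'M[T]_(a2, b)) (M3 : 'M[T]_(a3, b)) :
    'M[T]_(a1 + (a2 + a3), b) :=
  col_mx M1 (col_mx M2 M3).

Definition diag3 (F : realType) (a1 b1 a2 a3 : nat) (M : 'M[F]_(a1, b1)) :
    'M[F]_(a1 + (a2 + a3), b1 + (a2 + a3)) :=
  block3 M 0 0 0 1%:M 0 0 0 1%:M.
Arguments diag3 {F a1 b1} a2 a3 M.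

Definition psdmx (F : realType) (n : nat) (M : 'M[F]_n) : Prop :=
  M^T = M /\ forall x : 'cV[F]_n, 0 <= (x^T *m M *m x) 0 0.

Definition pdmx (F : realType) (n : nat) (M : 'M[F]_n) : Prop :=
  M^T = M /\ forall x : 'cV[F]_n, x != 0 -> 0 < (x^T *m M *m x) 0 0.

(* is_trig_mx: lower triangular. *)
Definition cholesky (F : realType) (n : nat) (M K : 'M[F]_n) : Prop :=
  [/\ is_trig_mx K, forall i, 0 < K i i & M = K *m K^T].

(* The matrix B is not constrained by the port-Hamiltonian conditions. *)
Definition pHDAE_conditions (F : realType) (n m : nat)
    (E Q J R : 'M[F]_n) (P : 'M[F]_(n, m)) (S N : 'M[F]_m) : Prop :=
  [/\ S^T = S /\ N^T = - N,
      Q^T *m J^T *m Q = - (Q^T *m J *m Q) /\ Q^T *m E = E^T *m Q,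
      psdmx (Q^T *m E)
    & psdmx (block_mx (Q^T *m R *m Q) (Q^T *m P) (P^T *m Q) S)].

(* The system E x' = (J - R) Q x + B u, y = B^T Q x, i.e. P = S = N = 0. *)
Record system (F : realType) (n m : nat) := System {
  sysE : 'M[F]_n;
  sysJ : 'M[F]_n;
  sysR : 'M[F]_n;
  sysQ : 'M[F]_n;
  sysB : 'M[F]_(n, m) }.

Definition pHDAE (F : realType) (n m : nat) (s : system F n m) : Prop :=
  @pHDAE_conditions F n m (sysE s) (sysQ s) (sysJ s) (sysR s) 0 0 0.

(* Change of state from x to U^T x. *)
Definition transform (F : realType) (n m : nat) (U : 'M[F]_n)
    (s : system F n m) : system F n m :=
  System (U^T *m sysE s *m (invmx U)^T)
         (U^T *m sysJ s *m U)
         (U^T *m sysR s *m U)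
         (invmx U *m sysQ s *m (invmx U)^T)
         (U^T *m sysB s).

Definition galerkin (F : realType) (n k m : nat) (V : 'M[F]_(n, k))
    (s : system F n m) : system F k m :=
  System (V^T *m sysE s *m V)
         (V^T *m sysJ s *m V)
         (V^T *m sysR s *m V)
         (V^T *m sysQ s *m V)
         (V^T *m sysB s).

Definition reduced (F : realType) (n1 n2 n3 r m : nat)
    (K : 'M[F]_n1) (V : 'M[F]_(n1, r)) (s : system F (n1 + (n2 + n3)) m) :
    system F (r + (n2 + n3)) m :=
  galerkin (diag3 n2 n3 V) (transform (diag3 n2 n3 K) s).

Definition cmx (F : realType) (a b : nat) (M : 'M[F]_(a, b)) :
    'M[F[i]]_(a, b) :=
  map_mx (fun x : F => real_complex F x) M.

Definition pencil (F : realType) (n m : nat) (s : system F n m) (z : F[i]) :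
    'M[F[i]]_n :=
  z *: cmx (sysE s) - cmx ((sysJ s - sysR s) *m sysQ s).

Definition regular_pencil (F : realType) (n m : nat) (s : system F n m) : Prop :=
  exists z : F[i], \det (pencil s z) != 0.

Definition transfer (F : realType) (n m : nat) (s : system F n m) (z : F[i]) :
    'M[F[i]]_m :=
  cmx ((sysB s)^T *m sysQ s) *m invmx (pencil s z) *m cmx (sysB s).

(* Shifts s0 in C u {oo} are elements of option F[i]; None is oo. *)

Definition regular_at (F : realType) (n m : nat) (s : system F n m)
    (s0 : option F[i]) : Prop :=
  if s0 is Some z0 then pencil s z0 \in unitmx else True.

(* MathComp subspaces are row spaces, hence the transposes: the row space of
   the result is spanned by the transposed columns of (z0 I - A)^-j b,
   1 <= j <= r, respectively of A^j b, 0 <= j < r. *)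
Definition krylov (F : realType) (n m : nat) (A : 'M[F[i]]_n)
    (b : 'M[F[i]]_(n, m)) (s0 : option F[i]) (r : nat) : 'M[F[i]]_n :=
  if s0 is Some z0 then
    (\sum_(j < r) <<((invmx (z0%:M - A) ^+ j.+1) *m b)^T>>)%MS
  else
    (\sum_(j < r) <<((A ^+ j) *m b)^T>>)%MS.

Definition arnoldi (F : realType) (n m r : nat) (A : 'M[F]_n)
    (b : 'M[F]_(n, m)) (s0 : option F[i]) (V : 'M[F]_(n, r)) : Prop :=
  V^T *m V = 1%:M /\ ((cmx V)^T == krylov (cmx A) (cmx b) s0 r)%MS.

(* Limits are taken in C, for the topology given by its norm; below C is F[i]. *)
Definition taylor_moments (C : numClosedFieldType) (m : nat)
    (G : C -> 'M[C]_m) (z0 : C) (mo : nat -> 'M[C]_m) : Prop :=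
  \forall z \near z0,
    (fun k : nat => \sum_(j < k) (z0 - z) ^+ j *: mo j) @ \oo --> G z.

(* At oo the Laurent expansion may contain a polynomial part
   \sum_(i < d) z^i p_i, which is not among the moments. The condition
   0 < rho matters: it makes rho real, so that rho < `|z| is satisfiable. *)
Definition markov_parameters (C : numClosedFieldType) (m : nat)
    (G : C -> 'M[C]_m) (mo : nat -> 'M[C]_m) : Prop :=
  exists (d : nat) (p : nat -> 'M[C]_m) (rho : C), 0 < rho /\
    forall z : C, rho < `|z| ->
      (fun k : nat => \sum_(i < d) z ^+ i *: p i
                      + \sum_(j < k) z ^- j.+1 *: mo j) @ \oo --> G z.

Definition moments (C : numClosedFieldType) (m : nat) (G : C -> 'M[C]_m)
    (s0 : option C) (mo : nat -> 'M[C]_m) : Prop :=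
  if s0 is Some z0 then taylor_moments G z0 mo else markov_parameters G mo.

(* The expansions are required to exist, so the comparison is not vacuous. *)
Definition match_moments (C : numClosedFieldType) (m r : nat)
    (G G' : C -> 'M[C]_m) (s0 : option C) : Prop :=
  [/\ exists mo, moments G s0 mo,
      exists mo', moments G' s0 mo'
    & forall mo mo', moments G s0 mo -> moments G' s0 mo' ->
        forall j : nat, (j < r)%N -> mo j = mo' j].

(* Main.v *)
Require Import Defs.
From mathcomp Require Import ring.

(** The change of state [U = diag(K, I, I)] turns [Q11] into the identity, so
    that the dynamic part of the transformed system is [x1' = A x1 + b u] with
    [A = K^T L11 K] and [b = K^T B1].  Since [L13 = L23 = 0], the matrix
    [sE - LQ] is block lower triangular with diagonal blocks [sI - A], [sI] and
    [- L33 Q33], so regularity of the pencil makes [L33] invertible.  Eliminating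
    [x2] and [x3] gives ([normal_form_transfer])
<<
      G(s) = D + c (sI - A)^-1 b,   D = - B3^T L33^-1 B3,
                                    c = b^T - B3^T L33^-1 L31 K.
>>
    Projecting with [diag(V, I, I)], where [V^T V = I], preserves this block
    shape ([galerkin_normal_form]) and replaces [(A, b, c)] by
    [(V^T A V, V^T b, c V)]; the feedthrough [D] stays the same.  So moment matching
    reduces to the classical statement about Krylov projection of
    [c (sI - A)^-1 b], proved in [galerkin_krylov_resolvent] for a finite shift
    and in [galerkin_krylov_power] for the shift at infinity.

    The moments are defined by expansions that are only required to converge.
    That they exist follows from the Neumann series of the resolvent
    ([taylor_moments_resolvent], [markov_parameters_resolvent]).  That they are
    determined by the transfer function follows from the uniqueness of power
    series coefficients ([power_series_unique]).

    The port-Hamiltonian conditions are conditions on [Q^T E], [Q^T J Q] and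
    [Q^T R Q], and are inherited whenever these matrices undergo a common
    congruence ([pHDAE_congruence]).  For the change of state this is immediate.
    For the projection it holds because, once [Q11] has become the identity,
    [Q] maps the range of [diag(V, I, I)] into itself, i.e. [Q V = V (V^T Q V)]
    ([pHDAE_galerkin]). *)

Local Open Scope classical_set_scope.
Local Open Scope ring_scope.

(** * Convergence *)

Lemma cvg_mxE (C : numFieldType) m n (f : nat -> 'M[C]_(m, n)) (l : 'M[C]_(m, n)) :
  f @ \oo --> l <-> forall i j, (fun k => f k i j) @ \oo --> l i j.
Proof.
split=> [/cvg_ballP fl i j | fl]; apply/cvg_ballP => e e0.
  by have := fl e e0; apply: filterS => k [_]; exact.
have : forall ij : 'I_m * 'I_n,
    \forall k \near \oo, ball (l ij.1 ij.2) e (f k ij.1 ij.2).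
  by move=> [i j]; move/cvg_ballP: (fl i j); exact.
by move=> /filter_forall; apply: filterS => k H; split=> // i j; exact: (H (i, j)).
Qed.

(** Bernoulli's inequality [(1 + d) ^ k >= 1 + k d], in a form that avoids
    division by [q]. *)
Lemma expr_bernoulli_le1 (C : numDomainType) (q : C) k :
  0 <= q -> q <= 1 -> q ^+ k * (1 + k%:R * (1 - q)) <= 1.
Proof.
move=> q0 q1; elim: k => [|k IHk]; first by rewrite expr0 mul0r addr0 mulr1.
apply: le_trans IHk; rewrite -subr_ge0 exprSr -natr1.
have -> : q ^+ k * (1 + k%:R * (1 - q)) - q ^+ k * q * (1 + (k%:R + 1) * (1 - q))
  = q ^+ k * ((k%:R + 1) * (1 - q) ^+ 2) by ring.
by rewrite !mulr_ge0 ?exprn_ge0 ?subr_ge0 // addr_ge0.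
Qed.

(** The Archimedean hypothesis is what makes [q ^ k] tend to 0.  It is an
    explicit hypothesis so that the lemma applies to fields with a partial order,
    such as the complex numbers. *)
Lemma cvg_geometric_error (C : numFieldType) (f : nat -> C) (l c q : C) :
  Num.archimedean_axiom C -> 0 <= q -> q < 1 ->
  (forall k, `|l - f k| <= c * q ^+ k) -> f @ \oo --> l.
Proof.
move=> archi q0 q1 fE; apply/cvgrPdist_lt => e e0.
have c0 : 0 <= c.
  by have := le_trans (normr_ge0 _) (fE 0%N); rewrite expr0 mulr1.
have d0 : 0 < 1 - q by rewrite subr_gt0.
have [N] := archi (c / (e * (1 - q))).
rewrite ger0_norm; last by rewrite divr_ge0 // mulr_ge0 // ltW.
rewrite ltr_pdivrMr ?mulr_gt0 // => cN.
exists N => // k /= Nk; apply: le_lt_trans (fE k) _.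
have p0 : 0 < 1 + k%:R * (1 - q) by rewrite ltr_wpDr // mulr_ge0 // ltW.
apply: (@le_lt_trans _ _ (c / (1 + k%:R * (1 - q)))).
  by rewrite ler_pdivlMr // -mulrA ler_piMr // expr_bernoulli_le1 // ltW.
rewrite ltr_pdivrMr //; apply: lt_le_trans cN _.
rewrite mulrCA ler_pM2l // ler_wpDl // ler_pM2r //.
by rewrite ler_nat.
Qed.

Lemma complex_archimedean (F : realType) : Num.archimedean_axiom F[i].
Proof.
case=> a b; rewrite normc_def /=.
set x := Num.sqrt _; have [n xn] := ex_intro (fun n => x < n%:R) _ (archi_boundP (sqrtr_ge0 _)).
exists n; rewrite -(rmorph_nat (real_complex F)) ltcE /= eqxx; exact: xn.
Qed.

(** * Uniqueness of power series coefficients *)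

Lemma geometric_half_le (C : numFieldType) (t : C) n :
  0 <= t -> t <= 2^-1 -> \sum_(i < n) t ^+ i.+1 <= t * 2.
Proof.
move=> t0 t2; elim: n => [|n IHn]; first by rewrite big_ord0 mulr_ge0.
rewrite big_ord_recl expr1 mulr_natr mulr2n lerD2l.
under eq_bigr do rewrite exprS.
rewrite -mulr_sumr -[leRHS]mulr1 ler_wpM2l //.
apply: le_trans IHn _.
by apply: le_trans (ler_wpM2r _ t2) _ => //; rewrite mulVf.
Qed.

(** Convergence at one point [w0] bounds all the terms by some [B].  At [t * w0] with
    [t <= 1/2] the terms after the first then add up to at most [2 t B], so the first
    coefficient is [O(t)], for every small [t].  Only points [w] other than 0 are used,
    so that the lemma also serves for expansions at infinity, where [w = 1/z]. *)
Lemma power_series_coef0 (C : numFieldType) (a : nat -> C) (rho : C) :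
  0 < rho ->
  (forall w, 0 < `|w| -> `|w| < rho ->
     (fun k => \sum_(j < k) w ^+ j * a j) @ \oo --> (0 : C)) ->
  a 0%N = 0.
Proof.
move=> rho0 aw.
pose w0 := rho / 2.
have w0_gt0 : 0 < w0 by rewrite divr_gt0.
have w0rho : w0 < rho by rewrite ltr_pdivrMr // ltr_pMr // ltr1n.
pose b i := w0 ^+ i * a i.
have [B bB] : exists B, forall i, `|b i| <= B.
  have := aw w0; rewrite gtr0_norm // => /(_ w0_gt0 w0rho).
  move=> /cvgrPdist_lt /(_ _ ltr01) [N _ HN].
  exists (2 + \sum_(i < N) `|b i|) => i.
  have [iN|Ni] := ltnP i N.
    apply: (@le_trans _ _ (\sum_(i < N) `|b i|)); last by rewrite lerDr.
    by rewrite (bigD1 (Ordinal iN)) //= lerDl sumr_ge0.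
  have := HN i Ni; have := HN i.+1 (leqW Ni).
  rewrite /= !sub0r !normrN big_ord_recr /= => h1 h2.
  have -> : b i = (\sum_(j < i) w0 ^+ j * a j + w0 ^+ i * a i)
                  - \sum_(j < i) w0 ^+ j * a j by rewrite /b; ring.
  (* From the index [N] on, a term is the difference of two partial sums of norm < 1. *)
  apply: (@le_trans _ _ 2); last by rewrite lerDl sumr_ge0.
  apply: le_trans (ler_normB _ _) _.
  by rewrite -[2]/(1 + 1) lerD // ltW.
have B0 : 0 <= B by apply: le_trans (bB 0%N).
have small t : 0 < t -> t <= 2^-1 -> `|a 0%N| <= t * (1 + 2 * B).
  move=> t0 t2.
  have t1 : t < 1 by apply: le_lt_trans t2 _; rewrite invf_lt1 ?ltr1n.
  have tw0 : 0 < t * w0 by rewrite mulr_gt0.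
  have := aw (t * w0); rewrite gtr0_norm // => /(_ tw0).
  have -> : t * w0 < rho.
    by apply: lt_trans w0rho; rewrite gtr_pMl.
  move=> /(_ isT) /cvgrPdist_lt /(_ _ t0) [N _ /(_ N.+1 (leqnSn N))] /=.
  rewrite sub0r normrN big_ord_recl expr0 mul1r => hS.
  set S := \sum_(i < N) _ in hS.
  have SB : `|S| <= t * 2 * B.
    apply: le_trans (ler_norm_sum _ _ _) _.
    apply: (@le_trans _ _ (\sum_(i < N) t ^+ i.+1 * B)).
      apply: ler_sum => i _.
      rewrite lift0 exprMn -mulrA normrM ger0_norm ?exprn_ge0 ?(ltW t0) //.
      by rewrite ler_wpM2l ?exprn_ge0 ?(ltW t0) // bB.
    by rewrite -mulr_suml ler_wpM2r // geometric_half_le // ltW.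
  rewrite -[a 0%N](addrK S) mulrDr mulr1 mulrA.
  by apply: le_trans (ler_normB _ _) _; rewrite lerD // ltW.
apply/eqP/contraT => a0.
have a0' : 0 < `|a 0%N| by rewrite normr_gt0.
have B1 : 0 < 1 + 2 * B by rewrite ltr_pwDl // mulr_ge0.
(* For this [x] the choice [t = |a 0| / x] satisfies both [t <= 1/2] and
   [t * (1 + 2 B) < |a 0|], against [small]. *)
pose x := 2 * `|a 0%N| + (1 + 2 * B).
have x0 : 0 < x by rewrite addr_gt0 // mulr_gt0.
have := small (`|a 0%N| / x); rewrite divr_gt0 // => /(_ isT).
have -> : `|a 0%N| / x <= 2^-1.
  by rewrite ler_pdivrMr // ler_pdivlMl // lerDl ltW.
move=> /(_ isT); rewrite mulrAC -mulrA ler_pMr // ler_pdivlMr // mul1r /x gerDr.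
by rewrite pmulr_rle0 // => /(lt_le_trans a0'); rewrite ltxx.
Qed.

(** Once [a 0 = 0] is known, division by [w] shifts the coefficients. *)
Lemma power_series_unique (C : numFieldType) (a : nat -> C) (rho : C) :
  0 < rho ->
  (forall w, 0 < `|w| -> `|w| < rho ->
     (fun k => \sum_(j < k) w ^+ j * a j) @ \oo --> (0 : C)) ->
  forall j, a j = 0.
Proof.
move=> rho0 aw j; elim: j a aw => [|j IHj] a aw.
  exact: power_series_coef0 rho0 aw.
apply: (IHj (fun j => a j.+1)) => w w0 wrho.
have wn0 : w != 0 by rewrite -normr_gt0.
have a0 := power_series_coef0 rho0 aw.
suff -> : (fun k => \sum_(j < k) w ^+ j * a j.+1) =
          (fun k => w^-1 * \sum_(j < k.+1) w ^+ j * a j).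
  have := aw w w0 wrho; rewrite -cvg_shiftS => h.
  have := @cvgMl_tmp C _ _ _ _ w^-1 0 h; rewrite mulr0; exact.
apply/funext => k; rewrite big_ord_recl a0 mulr0 add0r mulr_sumr.
by apply: eq_bigr => i _; rewrite lift0 exprS !mulrA mulVf // mul1r.
Qed.

(** * The Neumann series *)

(** The entrywise l1 norm: submultiplicative for rectangular matrices of all
    sizes, the empty ones included. *)
Definition mx_norm1 (C : numDomainType) m n (A : 'M[C]_(m, n)) : C :=
  \sum_i \sum_j `|A i j|.

Section Norm1.
Context {C : numDomainType}.
Implicit Types m n p : nat.

Lemma mx_norm1_ge0 m n (A : 'M[C]_(m, n)) : 0 <= mx_norm1 A.
Proof. by apply: sumr_ge0 => i _; apply: sumr_ge0. Qed.

Lemma mx_norm1_entry m n (A : 'M[C]_(m, n)) i j : `|A i j| <= mx_norm1 A.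
Proof.
rewrite /mx_norm1 (bigD1 i) //= (bigD1 j) //= -addrA lerDl addr_ge0 ?sumr_ge0 //.
by move=> k _; apply: sumr_ge0.
Qed.

Lemma mx_norm1_eq0 m n (A : 'M[C]_(m, n)) : mx_norm1 A <= 0 -> A = 0.
Proof.
move=> A0; apply/matrixP => i j; rewrite mxE; apply/eqP.
by rewrite -normr_le0; apply: le_trans (mx_norm1_entry A i j) A0.
Qed.

Lemma mx_norm1M m n p (A : 'M[C]_(m, n)) (B : 'M[C]_(n, p)) :
  mx_norm1 (A *m B) <= mx_norm1 A * mx_norm1 B.
Proof.
rewrite /mx_norm1 mulr_suml; apply: ler_sum => i _.
rewrite mulr_suml.
apply: (@le_trans _ _ (\sum_k \sum_j `|A i j| * `|B j k|)).
  apply: ler_sum => k _; rewrite mxE; apply: le_trans (ler_norm_sum _ _ _) _.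
  by apply: ler_sum => j _; rewrite normrM.
rewrite exchange_big; apply: ler_sum => j _ /=.
rewrite -mulr_sumr ler_wpM2l // (bigD1 j) //= lerDl.
by apply: sumr_ge0 => k _; apply: sumr_ge0.
Qed.

Lemma mx_norm1Z m n (a : C) (A : 'M[C]_(m, n)) :
  mx_norm1 (a *: A) = `|a| * mx_norm1 A.
Proof.
rewrite /mx_norm1 mulr_sumr; apply: eq_bigr => i _; rewrite mulr_sumr.
by apply: eq_bigr => j _; rewrite mxE normrM.
Qed.

(** The factor [B] absorbs the case [k = 0], where the norm of the identity
    matrix can exceed 1. *)
Lemma mx_norm1X m n (X : 'M[C]_n) (B : 'M[C]_(n, m)) k :
  mx_norm1 (X ^+ k *m B) <= mx_norm1 B * mx_norm1 X ^+ k.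
Proof.
elim: k => [|k IHk]; first by rewrite !expr0 mulr1 mul1mx.
rewrite !exprS -[X * _]/(X *m _) -mulmxA; apply: le_trans (mx_norm1M _ _) _.
by rewrite mulrCA ler_wpM2l ?mx_norm1_ge0.
Qed.
End Norm1.

(** A matrix [Z] with [Z = Z X] satisfies [|Z| <= |Z| |X|], hence vanishes; the
    left kernel of [1 - X] is such a [Z]. *)
Lemma neumann_unit (C : numFieldType) n (X : 'M[C]_n) :
  mx_norm1 X < 1 -> 1%:M - X \in unitmx.
Proof.
move=> X1; rewrite -row_free_unit -kermx_eq0; apply/eqP.
set Z := kermx _.
have ZX : Z = Z *m X.
  by apply/eqP; rewrite -subr_eq0 -{1}[Z]mulmx1 -mulmxBr mulmx_ker.
apply: mx_norm1_eq0; have := mx_norm1M Z X; rewrite -ZX -subr_le0.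
rewrite -{1}[mx_norm1 Z]mulr1 -mulrBr pmulr_lle0 // subr_gt0 //.
Qed.

(** The error after [k] terms is [c (1 - X)^-1 X^k b], of norm [O(|X|^k)]. *)
Lemma neumann_series (C : numFieldType) n p q (D : 'M[C]_(p, q))
    (c : 'M[C]_(p, n)) (X : 'M[C]_n) (b : 'M[C]_(n, q)) :
  Num.archimedean_axiom C -> mx_norm1 X < 1 ->
  (fun k => D + \sum_(j < k) (c *m X ^+ j *m b)) @ \oo -->
    D + c *m invmx (1%:M - X) *m b.
Proof.
move=> archi X1; have U := neumann_unit X1.
apply/cvg_mxE => i j.
apply: (@cvg_geometric_error _ _ _ (mx_norm1 (c *m invmx (1%:M - X)) * mx_norm1 b) (mx_norm1 X)) => //.
  exact: mx_norm1_ge0.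
move=> k.
have -> : (D + c *m invmx (1%:M - X) *m b) i j -
   (D + \sum_(j < k) (c *m X ^+ j *m b)) i j =
   (c *m invmx (1%:M - X) *m (X ^+ k *m b)) i j.
  have <- : D + c *m invmx (1%:M - X) *m b - (D + \sum_(j < k) (c *m X ^+ j *m b))
         = c *m invmx (1%:M - X) *m (X ^+ k *m b).
    have -> : c *m invmx (1%:M - X) *m (X ^+ k *m b) =
        c *m invmx (1%:M - X) *m b - c *m (\sum_(j < k) X ^+ j) *m b.
      have -> : \sum_(j < k) X ^+ j = invmx (1%:M - X) *m (1%:M - X ^+ k).
        apply: (canRL (mulKmx U)).
        by rewrite -[LHS]/((1 - X) * _) -opprB mulNr -subrX1 opprB.
      by rewrite !mulmxBr mulmxBl mulmx1 !mulmxA subKr.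
    by rewrite mulmx_sumr mulmx_suml opprD addrACA subrr add0r.
  by rewrite !mxE.
apply: le_trans (mx_norm1_entry _ _ _) _; apply: le_trans (mx_norm1M _ _) _.
by rewrite -mulrA ler_wpM2l ?mx_norm1_ge0 // mx_norm1X.
Qed.

(** * Uniqueness of moments *)

Lemma near_dist (C : numFieldType) (z0 : C) (P : C -> Prop) :
  (\forall z \near z0, P z) <->
  exists2 rho : C, 0 < rho & forall z, `|z0 - z| < rho -> P z.
Proof. exact: nbhs_ballP. Qed.

Lemma cvg_mx_sub_entry (C : numFieldType) m n (f g : nat -> 'M[C]_(m, n))
    (l : 'M[C]_(m, n)) i j :
  f @ \oo --> l -> g @ \oo --> l ->
  (fun k => f k i j - g k i j) @ \oo --> (0 : C).
Proof.
move=> /cvg_mxE/(_ i j) fl /cvg_mxE/(_ i j) gl.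
by have := cvgB fl gl; rewrite subrr; exact.
Qed.

Lemma taylor_moments_unique (C : numClosedFieldType) m (G : C -> 'M[C]_m) z0 mo mo' :
  taylor_moments G z0 mo -> taylor_moments G z0 mo' -> forall j, mo j = mo' j.
Proof.
move=> H H'; have [rho rho0 Hrho] := (near_dist z0 _).1 (filterI H H').
move=> j; apply/matrixP => k l; apply/eqP; rewrite -subr_eq0; apply/eqP; move: j.
apply: (@power_series_unique _ (fun j => mo j k l - mo' j k l) rho) => // w w0 wrho.
have [h h'] : _ /\ _ := Hrho (z0 - w) ltac:(by rewrite subKr).
have := cvg_mx_sub_entry k l h h'; set f := (X in X @ _ --> _).
suff -> : f = (fun n => \sum_(j < n) w ^+ j * (mo j k l - mo' j k l)) by [].
apply/funext => n; rewrite /f !summxE -sumrB; apply: eq_bigr => i _.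
by rewrite !mxE mulrBr subKr.
Qed.

(** Padding with zeros gives two polynomial parts the same number of terms. *)
Lemma sum_scale_pad (C : comPzRingType) m n (p : nat -> 'M[C]_(m, n)) d D (z : C) i j :
  (d <= D)%N ->
  (\sum_(e < d) z ^+ e *: p e) i j
  = \sum_(e < D) z ^+ e * (if (e < d)%N then p e i j else 0).
Proof.
move=> dD; rewrite summxE (big_ord_widen D (fun e => (z ^+ e *: p e) i j) dD).
by rewrite big_mkcond; apply: eq_bigr => e _; case: ifP; rewrite ?mxE ?mulr0.
Qed.

(** Put [w = 1/z].  The difference of two expansions, multiplied by [w ^ D] where [D]
    bounds the lengths of both polynomial parts, is a power series in [w] that tends
    to 0; its coefficient of index [D + 1 + j] is the difference of the [j]-th Markov
    parameters. *)
Lemma markov_parameters_unique (C : numClosedFieldType) m (G : C -> 'M[C]_m) mo mo' :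
  markov_parameters G mo -> markov_parameters G mo' -> forall j, mo j = mo' j.
Proof.
move=> [d [p [rho [rho0 H]]]] [d' [p' [rho' [rho0' H']]]] j.
apply/matrixP => k l; apply/eqP; rewrite -subr_eq0; apply/eqP; move: j.
pose D := maxn d d'.
pose P (i : nat) : C := (if (i < d)%N then p i k l else 0)
                      - (if (i < d')%N then p' i k l else 0).
pose a i : C := if (i <= D)%N then (if i is 0 then 0 else P (D - i)%N)
            else mo (i - D.+1)%N k l - mo' (i - D.+1)%N k l.
suff a0 : forall i, a i = 0.
  move=> j; have := a0 (D.+1 + j)%N.
  by rewrite /a leqNgt ltnS leq_addr /= addKn.
have r0 : 0 < rho + rho' by rewrite addr_gt0.
apply: (@power_series_unique _ a (rho + rho')^-1); first by rewrite invr_gt0.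
move=> w w0 wlt.
have wn0 : w != 0 by rewrite -normr_gt0.
have w1 : rho + rho' < `|w^-1|.
  by rewrite normfV -[ltLHS]invrK ltf_pV2 // posrE invr_gt0.
have h := H w^-1 (le_lt_trans _ w1); have {}h := h ltac:(by rewrite lerDl ltW).
have h' := H' w^-1 (le_lt_trans _ w1); have {}h' := h' ltac:(by rewrite lerDr ltW).
have := cvg_mx_sub_entry k l h h'; set f := (X in X @ _ --> _) => fl.
rewrite -(cvg_shiftn D.+1).
suff -> : [sequence \sum_(j < n + D.+1) w ^+ j * a j]_n = (fun n => w ^+ D * f n).
  have := @cvgMl_tmp C _ _ _ _ (w ^+ D) 0 fl.
  by rewrite mulr0; exact.
apply/funext => n /=; rewrite /f addnC big_split_ord /= big_ord_recl.
rewrite [a ord0]/a /= mulr0 add0r [X in _ * (X - _)]mxE [X in _ * (_ - X)]mxE.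
rewrite !(sum_scale_pad _ _ _ _ (leq_maxl d d')) (sum_scale_pad _ _ _ _ (leq_maxr d d')) -/D.
rewrite !summxE opprD addrACA -!sumrB mulrDr; congr (_ + _).
  rewrite mulr_sumr [RHS](reindex_inj rev_ord_inj); apply: eq_bigr => i _.
  rewrite /bump leq0n add1n /= -mulrBr -/(P (D - i.+1)%N) mulrA /a ltn_ord.
  congr (_ * _); rewrite exprVn -expfB_cond ?(negbTE wn0) ?leq_subr //=.
  by rewrite subKn.
rewrite mulr_sumr; apply: eq_bigr => i _.
rewrite {1}/a leqNgt ltnS leq_addr /= addKn !mxE -mulrBr mulrA; congr (_ * _).
by rewrite exprVn invrK -exprD addnS addSn.
Qed.

(** * Existence of moments *)

Lemma invmx_uniq (C : comUnitRingType) n (A B : 'M[C]_n) :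
  A *m B = 1%:M -> invmx A = B.
Proof.
move=> AB; have [UA _] := mulmx1_unit AB.
by rewrite -[B](mulKmx UA) AB mulmx1.
Qed.

Lemma exprZ_mx (C : comPzRingType) n (a : C) (A : 'M[C]_n) k :
  (a *: A) ^+ k = a ^+ k *: A ^+ k.
Proof.
elim: k => [|k IHk]; first by rewrite !expr0 scale1r.
by rewrite !exprS IHk -!mulmxE -scalemxAl -scalemxAr scalerA.
Qed.

(** With [M = (z0 - A)^-1] one has [(z - A)^-1 = (1 - (z0 - z) M)^-1 M], to which the
    Neumann series applies. *)
Lemma taylor_moments_resolvent (C : numClosedFieldType) n m (G : C -> 'M[C]_m)
    (D : 'M[C]_m) (c : 'M[C]_(m, n)) (A : 'M[C]_n) (b : 'M[C]_(n, m)) (z0 : C) :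
  Num.archimedean_axiom C -> z0%:M - A \in unitmx ->
  (\forall z \near z0, G z = D + c *m invmx (z%:M - A) *m b) ->
  taylor_moments G z0
    (fun j => (if j is 0 then D else 0) + c *m invmx (z0%:M - A) ^+ j.+1 *m b).
Proof.
move=> archi U /near_dist[rho rho0 GE].
set M := invmx _.
pose mu := 1 + mx_norm1 M.
have mu0 : 0 < mu by rewrite ltr_pwDl // mx_norm1_ge0.
(* This radius is below both [rho] and [1 / mu]. *)
apply/near_dist; exists (rho / (1 + mu * rho)).
  by rewrite divr_gt0 // addr_gt0 // mulr_gt0.
have d0 : 0 < 1 + mu * rho by rewrite addr_gt0 // mulr_gt0.
move=> z; rewrite ltr_pdivlMr // => hz.
have z1 : `|z0 - z| < rho.
  apply: le_lt_trans hz; rewrite ler_peMr // lerDl mulr_ge0 // ltW //.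
have X1 : mx_norm1 ((z0 - z) *: M) < 1.
  rewrite mx_norm1Z; apply: (@le_lt_trans _ _ (`|z0 - z| * mu)).
    by rewrite ler_wpM2l // lerDr.
  rewrite -(ltr_pM2r rho0) mul1r -mulrA; apply: le_lt_trans hz.
  by rewrite ler_wpM2l // lerDr.
rewrite (GE _ z1).
have -> : invmx (z%:M - A) = invmx (1%:M - (z0 - z) *: M) *m M.
  have -> : z%:M - A = (z0%:M - A) *m (1%:M - (z0 - z) *: M).
    rewrite mulmxBr mulmx1 -scalemxAr mulmxV // scalemx1 raddfB /=.
    by rewrite opprB [RHS]addrC addrA subrK.
  apply: invmx_uniq; rewrite mulmxA -(mulmxA (_ - A)) mulmxV ?neumann_unit //.
  by rewrite mulmx1 mulmxV.
rewrite mulmxA -mulmxA.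
have := @neumann_series _ _ _ _ D c _ (M *m b) archi X1.
(* The constant [D] sits in the term of index 0, so the partial sums agree as soon
   as that term is present. *)
apply: cvg_trans; apply: near_eq_cvg.
exists 1%N => // -[//|k] _ /=.
rewrite !big_ord_recl !expr0 scale1r addrA /=.
congr (_ + _); first by rewrite mulmx1 expr1 mulmxA.
apply: eq_bigr => i _; rewrite /bump leq0n add1n add0r exprZ_mx.
by rewrite -scalemxAr -scalemxAl [M ^+ i.+2]exprSr !mulmxA.
Qed.

(** The Neumann series of [(z - A)^-1 = z^-1 (1 - A / z)^-1]. *)
Lemma markov_parameters_resolvent (C : numClosedFieldType) n m (G : C -> 'M[C]_m)
    (D : 'M[C]_m) (c : 'M[C]_(m, n)) (A : 'M[C]_n) (b : 'M[C]_(n, m)) (rho : C) :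
  Num.archimedean_axiom C -> 0 < rho ->
  (forall z, rho < `|z| -> G z = D + c *m invmx (z%:M - A) *m b) ->
  markov_parameters G (fun j => c *m A ^+ j *m b).
Proof.
move=> archi rho0 GE.
exists 1%N, (fun _ => D), (rho + mx_norm1 A); split.
  by rewrite ltr_pwDl // mx_norm1_ge0.
move=> z hz.
have rz : rho < `|z| by apply: le_lt_trans hz; rewrite lerDl mx_norm1_ge0.
have z0 : z != 0 by rewrite -normr_gt0; apply: lt_trans rz.
have X1 : mx_norm1 (z^-1 *: A) < 1.
  rewrite mx_norm1Z normfV mulrC ltr_pdivrMr ?normr_gt0 // mul1r.
  by apply: le_lt_trans hz; rewrite lerDr ltW.
rewrite (GE _ rz).
have -> : invmx (z%:M - A) = z^-1 *: invmx (1%:M - z^-1 *: A).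
  have -> : z%:M - A = z *: (1%:M - z^-1 *: A).
    by rewrite scalerBr scalerA mulfV // scale1r scalemx1.
  by rewrite invmxZ // unitmxZ ?unitfE // neumann_unit.
rewrite -scalemxAr -scalemxAl scalemxAr.
have := @neumann_series _ _ _ _ D c _ (z^-1 *: b) archi X1.
apply: cvg_trans; apply: near_eq_cvg; apply: nearW => k /=.
rewrite big_ord_recl big_ord0 expr0 scale1r addr0; congr (_ + _).
apply: eq_bigr => i _.
by rewrite exprZ_mx -!scalemxAr -!scalemxAl scalerA exprVn exprS invfM.
Qed.

(** * Block matrices *)

Lemma mul_block3 (C : pzSemiRingType) a1 a2 a3 b1 b2 b3 c1 c2 c3
    (M11 : 'M[C]_(a1, b1)) (M12 : 'M[C]_(a1, b2)) (M13 : 'M[C]_(a1, b3))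
    (M21 : 'M[C]_(a2, b1)) (M22 : 'M[C]_(a2, b2)) (M23 : 'M[C]_(a2, b3))
    (M31 : 'M[C]_(a3, b1)) (M32 : 'M[C]_(a3, b2)) (M33 : 'M[C]_(a3, b3))
    (N11 : 'M[C]_(b1, c1)) (N12 : 'M[C]_(b1, c2)) (N13 : 'M[C]_(b1, c3))
    (N21 : 'M[C]_(b2, c1)) (N22 : 'M[C]_(b2, c2)) (N23 : 'M[C]_(b2, c3))
    (N31 : 'M[C]_(b3, c1)) (N32 : 'M[C]_(b3, c2)) (N33 : 'M[C]_(b3, c3)) :
  block3 M11 M12 M13 M21 M22 M23 M31 M32 M33 *m
  block3 N11 N12 N13 N21 N22 N23 N31 N32 N33 =
  block3 (M11 *m N11 + (M12 *m N21 + M13 *m N31))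
         (M11 *m N12 + (M12 *m N22 + M13 *m N32))
         (M11 *m N13 + (M12 *m N23 + M13 *m N33))
         (M21 *m N11 + (M22 *m N21 + M23 *m N31))
         (M21 *m N12 + (M22 *m N22 + M23 *m N32))
         (M21 *m N13 + (M22 *m N23 + M23 *m N33))
         (M31 *m N11 + (M32 *m N21 + M33 *m N31))
         (M31 *m N12 + (M32 *m N22 + M33 *m N32))
         (M31 *m N13 + (M32 *m N23 + M33 *m N33)).
Proof.
rewrite /block3 mulmx_block mul_row_col mul_row_block mul_mx_row add_row_mx.
rewrite mul_col_mx mul_block_col add_col_mx mulmx_block mul_col_row.
by rewrite add_block_mx.
Qed.

Lemma mul_block3_col (C : pzSemiRingType) a1 a2 a3 b1 b2 b3 c
    (M11 : 'M[C]_(a1, b1)) (M12 : 'M[C]_(a1, b2)) (M13 : 'M[C]_(a1, b3))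
    (M21 : 'M[C]_(a2, b1)) (M22 : 'M[C]_(a2, b2)) (M23 : 'M[C]_(a2, b3))
    (M31 : 'M[C]_(a3, b1)) (M32 : 'M[C]_(a3, b2)) (M33 : 'M[C]_(a3, b3))
    (N1 : 'M[C]_(b1, c)) (N2 : 'M[C]_(b2, c)) (N3 : 'M[C]_(b3, c)) :
  block3 M11 M12 M13 M21 M22 M23 M31 M32 M33 *m col3 N1 N2 N3 =
  col3 (M11 *m N1 + (M12 *m N2 + M13 *m N3))
       (M21 *m N1 + (M22 *m N2 + M23 *m N3))
       (M31 *m N1 + (M32 *m N2 + M33 *m N3)).
Proof.
rewrite /block3 /col3 mul_block_col mul_row_col.
by rewrite mul_col_mx mul_block_col add_col_mx.
Qed.

Lemma tr_block3 (T : Type) a1 a2 a3 b1 b2 b3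
    (M11 : 'M[T]_(a1, b1)) (M12 : 'M[T]_(a1, b2)) (M13 : 'M[T]_(a1, b3))
    (M21 : 'M[T]_(a2, b1)) (M22 : 'M[T]_(a2, b2)) (M23 : 'M[T]_(a2, b3))
    (M31 : 'M[T]_(a3, b1)) (M32 : 'M[T]_(a3, b2)) (M33 : 'M[T]_(a3, b3)) :
  (block3 M11 M12 M13 M21 M22 M23 M31 M32 M33)^T =
  block3 M11^T M21^T M31^T M12^T M22^T M32^T M13^T M23^T M33^T.
Proof. by rewrite /block3 !tr_block_mx tr_row_mx tr_col_mx. Qed.

Lemma map_block3 (T S : Type) (f : T -> S) a1 a2 a3 b1 b2 b3
    (M11 : 'M[T]_(a1, b1)) (M12 : 'M[T]_(a1, b2)) (M13 : 'M[T]_(a1, b3))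
    (M21 : 'M[T]_(a2, b1)) (M22 : 'M[T]_(a2, b2)) (M23 : 'M[T]_(a2, b3))
    (M31 : 'M[T]_(a3, b1)) (M32 : 'M[T]_(a3, b2)) (M33 : 'M[T]_(a3, b3)) :
  map_mx f (block3 M11 M12 M13 M21 M22 M23 M31 M32 M33) =
  block3 (map_mx f M11) (map_mx f M12) (map_mx f M13) (map_mx f M21)
         (map_mx f M22) (map_mx f M23) (map_mx f M31) (map_mx f M32)
         (map_mx f M33).
Proof. by rewrite /block3 !map_block_mx map_row_mx map_col_mx. Qed.

Lemma sub_block3 (V : zmodType) a1 a2 a3 b1 b2 b3
    (M11 : 'M[V]_(a1, b1)) (M12 : 'M[V]_(a1, b2)) (M13 : 'M[V]_(a1, b3))
    (M21 : 'M[V]_(a2, b1)) (M22 : 'M[V]_(a2, b2)) (M23 : 'M[V]_(a2, b3))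
    (M31 : 'M[V]_(a3, b1)) (M32 : 'M[V]_(a3, b2)) (M33 : 'M[V]_(a3, b3))
    (N11 : 'M[V]_(a1, b1)) (N12 : 'M[V]_(a1, b2)) (N13 : 'M[V]_(a1, b3))
    (N21 : 'M[V]_(a2, b1)) (N22 : 'M[V]_(a2, b2)) (N23 : 'M[V]_(a2, b3))
    (N31 : 'M[V]_(a3, b1)) (N32 : 'M[V]_(a3, b2)) (N33 : 'M[V]_(a3, b3)) :
  block3 M11 M12 M13 M21 M22 M23 M31 M32 M33 -
  block3 N11 N12 N13 N21 N22 N23 N31 N32 N33 =
  block3 (M11 - N11) (M12 - N12) (M13 - N13) (M21 - N21) (M22 - N22)
         (M23 - N23) (M31 - N31) (M32 - N32) (M33 - N33).
Proof.
rewrite /block3 opp_block_mx opp_row_mx opp_col_mx opp_block_mx.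
by rewrite !add_block_mx add_row_mx add_col_mx.
Qed.

Lemma unitmx_lblock (C : comUnitRingType) n1 n2 (A : 'M[C]_n1)
    (B : 'M[C]_(n2, n1)) (D : 'M[C]_n2) :
  (block_mx A 0 B D \in unitmx) = (A \in unitmx) && (D \in unitmx).
Proof. by rewrite !unitmxE det_lblock unitrM. Qed.

Lemma unitmx_block3 (C : comUnitRingType) n1 n2 n3 (M11 : 'M[C]_n1)
    (M21 : 'M[C]_(n2, n1)) (M22 : 'M[C]_n2) (M31 : 'M[C]_(n3, n1))
    (M32 : 'M[C]_(n3, n2)) (M33 : 'M[C]_n3) :
  (block3 M11 0 0 M21 M22 0 M31 M32 M33 \in unitmx) =
  [&& M11 \in unitmx, M22 \in unitmx & M33 \in unitmx].
Proof. by rewrite /block3 row_mx0 !unitmx_lblock. Qed.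

(** * The normal form and its transfer function *)

Lemma cmxE (F : realType) a b (M : 'M[F]_(a, b)) : cmx M = map_mx (real_complex F) M.
Proof. by []. Qed.

Lemma cmxM (F : realType) a b c (M : 'M[F]_(a, b)) (N : 'M[F]_(b, c)) :
  cmx (M *m N) = cmx M *m cmx N.
Proof. by rewrite !cmxE map_mxM. Qed.

Lemma cmx_unit (F : realType) a (M : 'M[F]_a) : (cmx M \in unitmx) = (M \in unitmx).
Proof. by rewrite cmxE map_unitmx. Qed.

(** The shape shared by the transformed full system and the reduced system: the
    energy block of the dynamic variables is the identity. *)
Definition normal_form (F : realType) n1 n2 n3 m (s : system F (n1 + (n2 + n3)) m)
    (A : 'M[F]_n1) (L12 : 'M[F]_(n1, n2)) (L21 : 'M[F]_(n2, n1))
    (L22 : 'M[F]_n2) (L31 : 'M[F]_(n3, n1)) (L32 : 'M[F]_(n3, n2)) (L33 : 'M[F]_n3)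
    (Q31 : 'M[F]_(n3, n1)) (Q32 : 'M[F]_(n3, n2)) (Q33 : 'M[F]_n3)
    (b : 'M[F]_(n1, m)) (B2 : 'M[F]_(n2, m)) (B3 : 'M[F]_(n3, m)) : Prop :=
  [/\ sysE s = block3 1%:M 0 0 0 1%:M 0 0 0 0,
      sysJ s - sysR s = block3 A L12 0 L21 L22 0 L31 L32 L33,
      sysQ s = block3 1%:M 0 0 0 0 0 Q31 Q32 Q33
    & sysB s = col3 b B2 B3].

Section NormalForm.
Context {F : realType} {n1 n2 n3 m : nat} {s : system F (n1 + (n2 + n3)) m}
  {A : 'M[F]_n1} {L12 : 'M[F]_(n1, n2)} {L21 : 'M[F]_(n2, n1)}
  {L22 : 'M[F]_n2} {L31 : 'M[F]_(n3, n1)} {L32 : 'M[F]_(n3, n2)} {L33 : 'M[F]_n3}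
  {Q31 : 'M[F]_(n3, n1)} {Q32 : 'M[F]_(n3, n2)} {Q33 : 'M[F]_n3}
  {b : 'M[F]_(n1, m)} {B2 : 'M[F]_(n2, m)} {B3 : 'M[F]_(n3, m)}.
Context (sP : normal_form s A L12 L21 L22 L31 L32 L33 Q31 Q32 Q33 b B2 B3).
Implicit Type z : F[i].

Lemma normal_form_pencil z :
  pencil s z =
  block3 (z%:M - cmx A) 0 0 (- cmx L21) z%:M 0
         (- cmx (L31 + L33 *m Q31)) (- cmx (L33 *m Q32)) (- cmx (L33 *m Q33)).
Proof.
rewrite /pencil; have [-> -> -> _] := sP.
rewrite mul_block3 !(mulmx0, mulmx1, mul0mx, addr0, add0r).
rewrite !cmxE !map_block3 -mul_scalar_mx.
rewrite (_ : z%:M = block3 z%:M 0 0 0 z%:M 0 0 0 z%:M); last first.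
  by rewrite /block3 row_mx0 col_mx0 -!scalar_mx_block.
rewrite mul_block3 sub_block3 !map_mx1 !map_mx0.
by rewrite !(mulmx0, mulmx1, mul0mx, addr0, add0r, subr0, sub0r, oppr0).
Qed.

Lemma normal_form_pencil_unit z :
  (pencil s z \in unitmx) =
  [&& z%:M - cmx A \in unitmx, (z%:M : 'M[F[i]]_n2) \in unitmx, L33 \in unitmx
    & Q33 \in unitmx].
Proof.
rewrite normal_form_pencil unitmx_block3 -[- cmx (_ *m Q33)]scaleN1r unitmxZ ?unitrN1 //.
by rewrite cmx_unit unitmx_mul.
Qed.

(** The row vector [(c (z - A)^-1, 0, - B3^T L33^-1)] solves [X P = B^T Q], where [P] is
    the pencil: the last entry cancels the algebraic part, and what is left in the
    first block is [c]. *)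
Lemma normal_form_transfer z : pencil s z \in unitmx ->
  transfer s z = cmx (- (B3^T *m invmx L33 *m B3))
    + cmx (b^T - B3^T *m invmx L33 *m L31) *m invmx (z%:M - cmx A) *m cmx b.
Proof.
move=> U; move: (U); rewrite normal_form_pencil_unit => /and4P[UA _ U33 _].
pose c := b^T - B3^T *m invmx L33 *m L31.
pose W := cmx (B3^T *m invmx L33).
have BQ : cmx ((sysB s)^T *m sysQ s) =
   row_mx (cmx c *m invmx (z%:M - cmx A)) (row_mx 0 (- W)) *m pencil s z.
  rewrite normal_form_pencil.
  have [_ _ -> ->] := sP.
  rewrite /col3 /block3 !tr_col_mx !mul_row_block !mul_row_col.
  rewrite !mul_mx_row !(mulmx0, mulmx1, mul0mx, addr0, add0r).
  rewrite !mulNmx !mulmxN !opprK mulmxKV // -!cmxM !row_mx0 !add0r.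
  rewrite !mulmxDr !mulmxA !mulmxKV // !cmxE !map_row_mx.
  by rewrite /c [map_mx _ (b^T + _)]raddfD raddfB raddfD /= addrA subrK.
rewrite /transfer BQ mulmxK //; have [_ _ _ ->] := sP.
rewrite /col3 !cmxE !map_col_mx !mul_row_col mul0mx add0r -!cmxE.
by rewrite mulNmx -cmxM addrC !cmxE raddfN.
Qed.

End NormalForm.

(** With [X = P(z0)^-1 E] the pencil factors as [P(z) = P(z0) (1 - (z0 - z) X)]. *)
Lemma near_pencil_unit (F : realType) n m (s : system F n m) (z0 : F[i]) :
  pencil s z0 \in unitmx -> exists2 rho : F[i], 0 < rho &
    forall z, `|z0 - z| < rho -> pencil s z \in unitmx.
Proof.
move=> U; pose X := invmx (pencil s z0) *m cmx (sysE s).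
have X0 : 0 < 1 + mx_norm1 X by rewrite ltr_pwDl // mx_norm1_ge0.
exists (1 + mx_norm1 X)^-1; first by rewrite invr_gt0.
move=> z; rewrite -[_^-1]mul1r ltr_pdivlMr // mulrDr mulr1 => hz.
have -> : pencil s z = pencil s z0 *m (1%:M - (z0 - z) *: X).
  rewrite mulmxBr mulmx1 -scalemxAr mulKVmx // /pencil scalerBl.
  by rewrite addrAC opprB [z0 *: _ + _]addrC subrK.
rewrite unitmx_mul U neumann_unit // mx_norm1Z.
by apply: le_lt_trans hz; rewrite lerDr.
Qed.

Lemma galerkin_normal_form (F : realType) n1 n2 n3 m r (s : system F (n1 + (n2 + n3)) m)
    A L12 L21 L22 L31 L32 L33 Q31 Q32 Q33 b B2 B3 (V : 'M[F]_(n1, r)) :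
  V^T *m V = 1%:M ->
  normal_form s A L12 L21 L22 L31 L32 L33 Q31 Q32 Q33 b B2 B3 ->
  normal_form (galerkin (diag3 n2 n3 V) s)
    (V^T *m A *m V) (V^T *m L12) (L21 *m V) L22 (L31 *m V) L32 L33
    (Q31 *m V) Q32 Q33 (V^T *m b) B2 B3.
Proof.
move=> VV [eE eL eQ eB]; split=> /=.
- rewrite eE /diag3 tr_block3 !mul_block3 !trmx0 !trmx1.
  by rewrite !(mulmx0, mulmx1, mul0mx, mul1mx, addr0, add0r) VV.
- rewrite -mulmxBl -mulmxBr eL /diag3 tr_block3 !mul_block3 !trmx0 !trmx1.
  by rewrite !(mulmx0, mulmx1, mul0mx, mul1mx, addr0, add0r).
- rewrite eQ /diag3 tr_block3 !mul_block3 !trmx0 !trmx1.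
  by rewrite !(mulmx0, mulmx1, mul0mx, mul1mx, addr0, add0r) VV.
- rewrite eB /diag3 tr_block3 mul_block3_col !trmx0 !trmx1.
  by rewrite !(mulmx0, mulmx1, mul0mx, mul1mx, addr0, add0r).
Qed.

(** * Change of state *)

Lemma pencil_transform (F : realType) n m (s : system F n m) U z :
  U \in unitmx ->
  pencil (transform U s) z = cmx U^T *m pencil s z *m cmx (invmx U)^T.
Proof.
move=> UU; rewrite /pencil /= -mulmxBl -mulmxBr.
rewrite [X in _ = X *m _]mulmxBr [RHS]mulmxBl -scalemxAr -scalemxAl -!cmxM; congr (_ - cmx _).
by rewrite !mulmxA mulmxK.
Qed.

Lemma pencil_transform_unit (F : realType) n m (s : system F n m) U z :
  U \in unitmx ->
  (pencil (transform U s) z \in unitmx) = (pencil s z \in unitmx).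
Proof.
move=> UU; rewrite pencil_transform // !unitmx_mul !cmx_unit !unitmx_tr.
by rewrite unitmx_inv UU andbT.
Qed.

Lemma transfer_transform (F : realType) n m (s : system F n m) U z :
  U \in unitmx -> pencil s z \in unitmx ->
  transfer (transform U s) z = transfer s z.
Proof.
move=> UU UP; rewrite /transfer pencil_transform //.
have -> : invmx (cmx U^T *m pencil s z *m cmx (invmx U)^T) =
   cmx U^T *m invmx (pencil s z) *m cmx (invmx U)^T.
  apply: invmx_uniq.
  rewrite !mulmxA -(mulmxA _ (cmx (invmx U)^T)) -cmxM -trmx_mul mulmxV //.
  rewrite trmx1 [cmx 1%:M]cmxE map_mx1 mulmx1 -(mulmxA _ (pencil s z)) mulmxV //.
  by rewrite mulmx1 -cmxM -trmx_mul mulVmx // trmx1 cmxE map_mx1.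
have TU : (invmx U)^T *m U^T = 1%:M by rewrite -trmx_mul mulmxV // trmx1.
rewrite /= trmx_mul trmxK !mulmxA mulmxK // -cmxM -(mulmxA _ _ U^T) TU mulmx1.
by rewrite -(mulmxA _ (cmx (invmx U)^T)) -cmxM (mulmxA (invmx U)^T) TU mul1mx.
Qed.

Lemma cholesky_unit (F : realType) n (M K : 'M[F]_n) :
  cholesky M K -> K \in unitmx.
Proof.
by move=> [Ktrig Kpos _]; rewrite unitmxE det_trig // unitfE gt_eqF // prodr_gt0.
Qed.

Lemma invmx_diag3 (F : realType) n1 n2 n3 (K : 'M[F]_n1) :
  K \in unitmx -> invmx (diag3 n2 n3 K) = diag3 n2 n3 (invmx K).
Proof.
move=> UK; apply: invmx_uniq; rewrite /diag3 mul_block3.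
rewrite !(mulmx0, mulmx1, mul0mx, mul1mx, addr0, add0r) mulmxV //.
by rewrite /block3 row_mx0 col_mx0 -!scalar_mx_block.
Qed.

(** * The port-Hamiltonian structure *)

Lemma psdmx_congruence (F : realType) n k (M : 'M[F]_n) (T : 'M[F]_(n, k)) :
  psdmx M -> psdmx (T^T *m M *m T).
Proof.
move=> [Ms Mp]; split; first by rewrite !trmx_mul trmxK Ms mulmxA.
by move=> x; have := Mp (T *m x); rewrite trmx_mul !mulmxA.
Qed.

(** Symmetry, skew-symmetry and semidefiniteness are stable under congruence; the
    passivity matrix undergoes the congruence by [diag(T, I)]. *)
Lemma pHDAE_congruence (F : realType) n k m (s : system F n m) (s' : system F k m)
    (T : 'M[F]_(n, k)) :
  (sysQ s')^T *m sysE s' = T^T *m ((sysQ s)^T *m sysE s) *m T ->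
  (sysQ s')^T *m sysJ s' *m sysQ s' = T^T *m ((sysQ s)^T *m sysJ s *m sysQ s) *m T ->
  (sysQ s')^T *m sysR s' *m sysQ s' = T^T *m ((sysQ s)^T *m sysR s *m sysQ s) *m T ->
  pHDAE s -> pHDAE s'.
Proof.
move=> eE eJ eR [_ [skew _] pE pW]; split.
- by rewrite trmx0 oppr0.
- split; last first.
    have [+ _] : psdmx ((sysQ s')^T *m sysE s') by rewrite eE; exact: psdmx_congruence.
    by rewrite trmx_mul trmxK => ->.
  have tr3 p (Q X : 'M[F]_p) : Q^T *m X^T *m Q = (Q^T *m X *m Q)^T.
    by rewrite !trmx_mul trmxK mulmxA.
  have {}skew : ((sysQ s)^T *m sysJ s *m sysQ s)^T = - ((sysQ s)^T *m sysJ s *m sysQ s).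
    by rewrite -tr3.
  rewrite tr3 eJ [LHS]trmx_mul [X in _ *m X]trmx_mul skew trmxK.
  by rewrite mulNmx mulmxN mulmxA.
- by rewrite eE; exact: psdmx_congruence.
- have := psdmx_congruence (block_mx T 0 0 1%:M) pW.
  rewrite tr_block_mx !mulmx_block !trmx0 !trmx1.
  by rewrite !(mulmx0, mul0mx, addr0, mul1mx, mulmx1) eR.
Qed.

Lemma pHDAE_transform (F : realType) n m (s : system F n m) U :
  U \in unitmx -> pHDAE s -> pHDAE (transform U s).
Proof.
move=> UU; have TU : (invmx U)^T *m U^T = 1%:M by rewrite -trmx_mul mulmxV // trmx1.
apply: (@pHDAE_congruence _ _ _ _ _ _ (invmx U)^T) => /=;
  rewrite !trmx_mul !trmxK !mulmxA.
- by rewrite -(mulmxA _ _ U^T) TU mulmx1.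
- by rewrite -(mulmxA _ _ U^T) TU mulmx1 mulmxK.
- by rewrite -(mulmxA _ _ U^T) TU mulmx1 mulmxK.
Qed.

(** In general [V^T Q V] does not preserve the structure.  The invariance hypothesis
    says that projecting [Q] loses nothing: [V Q' = Q V] for the projected [Q'],
    whence [Q'^T (V^T X V) Q' = V^T (Q^T X Q) V] for every [X]. *)
Lemma pHDAE_galerkin (F : realType) n k m (s : system F n m) (V : 'M[F]_(n, k)) :
  sysQ s *m V = V *m (V^T *m sysQ s *m V) ->
  pHDAE s -> pHDAE (galerkin V s).
Proof.
rewrite /galerkin; set Q' := V^T *m sysQ s *m V => QV.
have QVT := congr1 trmx QV; rewrite [LHS]trmx_mul [RHS]trmx_mul in QVT.
apply: (@pHDAE_congruence _ _ _ _ _ _ V) => /=.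
- by rewrite -!mulmxA mulmxA -QVT !mulmxA.
- by rewrite -!mulmxA -QV mulmxA -QVT !mulmxA.
- by rewrite -!mulmxA -QV mulmxA -QVT !mulmxA.
Qed.

(** * Krylov spaces *)

Lemma krylov_sub (F : realType) n m (A : 'M[F[i]]_n) (b : 'M[F[i]]_(n, m)) s0 r j :
  (j < r)%N ->
  ((if s0 is Some z0 then invmx (z0%:M - A) ^+ j.+1 *m b else A ^+ j *m b)^T
   <= krylov A b s0 r)%MS.
Proof.
move=> jr; case: s0 => [z0|] /=;
  by apply: (sumsmx_sup (Ordinal jr)) => //=; rewrite genmxE.
Qed.

(** If the solution of [(z0 - A) y = x] lies in the range of [V], then it equals [V w]
    with [w] the solution of the projected equation with right-hand side [W x].  The
    next Krylov vector is such a solution, with the previous one as right-hand side,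
    so the iteration commutes with the projection as long as it stays in the range
    of [V]. *)
Lemma galerkin_krylov_resolvent (C : fieldType) n r m (A : 'M[C]_n)
    (b : 'M[C]_(n, m)) (V : 'M[C]_(n, r)) (W : 'M[C]_(r, n)) (z0 : C) k :
  W *m V = 1%:M -> z0%:M - A \in unitmx -> z0%:M - W *m A *m V \in unitmx ->
  (forall j, (j < k)%N -> exists w, invmx (z0%:M - A) ^+ j.+1 *m b = V *m w) ->
  forall j, (j < k)%N ->
  invmx (z0%:M - A) ^+ j.+1 *m b
  = V *m (invmx (z0%:M - W *m A *m V) ^+ j.+1 *m (W *m b)).
Proof.
move=> WV UA UAr span.
have project x w : invmx (z0%:M - A) *m x = V *m w ->
    w = invmx (z0%:M - W *m A *m V) *m (W *m x).
  move=> xw; rewrite -[x in RHS](mulKVmx UA) xw (mulmxA W) (mulmxA _ V).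
  have -> : W *m (z0%:M - A) *m V = z0%:M - W *m A *m V.
    by rewrite mulmxBr mulmxBl mul_mx_scalar -scalemxAl WV scalemx1.
  by rewrite mulKmx.
elim=> [|j IHj] jk.
  have [w e] := span 0%N jk; rewrite e; move: e; rewrite !expr1 => /project ->.
  by [].
have [w e] := span _ jk; rewrite e; congr (_ *m _).
move: e; rewrite exprS -mulmxE -mulmxA => /project ->.
rewrite (IHj (ltnW jk)) [in RHS]exprS -mulmxE -[RHS]mulmxA; congr (_ *m _).
by rewrite !mulmxA WV mul1mx.
Qed.

(** A vector [x] in the range of [V] is fixed by the projector [V W].  Hence
    [A (V y) = V (W A V) y] as long as [A (V y)] stays in that range. *)
Lemma galerkin_krylov_power (C : fieldType) n r m (A : 'M[C]_n)
    (b : 'M[C]_(n, m)) (V : 'M[C]_(n, r)) (W : 'M[C]_(r, n)) k :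
  W *m V = 1%:M ->
  (forall j, (j < k)%N -> exists w, A ^+ j *m b = V *m w) ->
  forall j, (j < k)%N -> A ^+ j *m b = V *m ((W *m A *m V) ^+ j *m (W *m b)).
Proof.
move=> WV span.
have project x w : x = V *m w -> x = V *m (W *m x).
  by move=> ->; rewrite (mulmxA W) WV mul1mx.
elim=> [|j IHj] jk; have [w /project e] := span _ jk; rewrite e; congr (_ *m _).
  by rewrite !expr0 !mul1mx.
by rewrite exprS -mulmxE -mulmxA (IHj (ltnW jk)) [in RHS]exprS -mulmxE !mulmxA.
Qed.

(** * Moment matching *)

(** By uniqueness, matching can be checked on any one choice of moments. *)
Lemma match_momentsP (C : numClosedFieldType) (m r : nat) (G G' : C -> 'M[C]_m)
    (s0 : option C) (mu mu' : nat -> 'M[C]_m) :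
  moments G s0 mu -> moments G' s0 mu' ->
  (forall j, (j < r)%N -> mu j = mu' j) -> match_moments r G G' s0.
Proof.
move=> Gmu Gmu' e; split; [by exists mu | by exists mu' |].
move=> mo mo' Gmo Gmo' j jr.
have uniq H nu nu' : moments H s0 nu -> moments H s0 nu' -> nu j = nu' j.
  case: (s0) => [z0|] h h'; first exact: taylor_moments_unique h h' j.
  exact: markov_parameters_unique h h' j.
by rewrite (uniq _ _ _ _ Gmo Gmu) (e j jr) (uniq _ _ _ _ Gmu' Gmo').
Qed.

Definition normal_form_moments (F : realType) n1 n3 m (A : 'M[F]_n1)
    (L31 : 'M[F]_(n3, n1)) (L33 : 'M[F]_n3) (b : 'M[F]_(n1, m)) (B3 : 'M[F]_(n3, m))
    (s0 : option F[i]) (j : nat) : 'M[F[i]]_m :=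
  let D := cmx (- (B3^T *m invmx L33 *m B3)) in
  let c := cmx (b^T - B3^T *m invmx L33 *m L31) in
  if s0 is Some z0 then
    (if j is 0 then D else 0) + c *m invmx (z0%:M - cmx A) ^+ j.+1 *m cmx b
  else c *m cmx A ^+ j *m cmx b.

(** The function [G] need only agree with the transfer function of [t] where the pencil
    is invertible.  This is all that holds for the full and the transformed systems,
    since [invmx] of a singular matrix is that matrix itself. *)
Lemma normal_form_momentsP (F : realType) n1 n2 n3 m (t : system F (n1 + (n2 + n3)) m)
    (G : F[i] -> 'M[F[i]]_m) A L12 L21 L22 L31 L32 L33 Q31 Q32 Q33 b B2 B3 s0 :
  normal_form t A L12 L21 L22 L31 L32 L33 Q31 Q32 Q33 b B2 B3 ->
  L33 \in unitmx -> Q33 \in unitmx -> regular_at t s0 ->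
  (forall z, pencil t z \in unitmx -> G z = transfer t z) ->
  moments G s0 (normal_form_moments A L31 L33 b B3 s0).
Proof.
move=> tP UL UQ; have archi := @complex_archimedean F.
case: s0 => [z0|] /= reg GE.
  have := reg; rewrite (normal_form_pencil_unit tP) => /and4P[UA _ _ _].
  apply: taylor_moments_resolvent => //.
  apply/near_dist; have [rho rho0 near_reg] := near_pencil_unit reg.
  exists rho => // z zrho.
  by rewrite GE ?near_reg // (normal_form_transfer tP) // near_reg.
have rho0 : 0 < 1 + mx_norm1 (cmx A) by rewrite ltr_pwDl // mx_norm1_ge0.
apply: (markov_parameters_resolvent archi rho0) => z hz.
have zgt0 : 0 < `|z| by apply: lt_trans hz.
have z0 : z != 0 by rewrite -normr_gt0.
suff Uz : pencil t z \in unitmx by rewrite GE // (normal_form_transfer tP).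
rewrite (normal_form_pencil_unit tP) UL UQ !andbT.
have -> : z%:M - cmx A = z *: (1%:M - z^-1 *: cmx A).
  by rewrite scalerBr scalerA mulfV // scale1r scalemx1.
rewrite -[z%:M in X in _ && X]scalemx1 !unitmxZ ?unitfE // unitmx1 andbT.
rewrite neumann_unit // mx_norm1Z normfV mulrC ltr_pdivrMr // mul1r.
by apply: le_lt_trans hz; rewrite lerDr.
Qed.

(** The [j]-th moments are [c M^(j+1) b] and [c V M_r^(j+1) V^T b] at a finite shift
    (plus the common [D] when [j = 0]), with [M] and [M_r] the resolvents of [A] and
    [V^T A V] there, and [c A^j b] and [c V (V^T A V)^j V^T b] at infinity. *)
Lemma normal_form_match_moments (F : realType) n1 n2 n3 m r
    (t : system F (n1 + (n2 + n3)) m) (G : F[i] -> 'M[F[i]]_m)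
    A L12 L21 L22 L31 L32 L33 Q31 Q32 Q33 b B2 B3 s0 (V : 'M[F]_(n1, r)) :
  let t_r := galerkin (diag3 n2 n3 V) t in
  normal_form t A L12 L21 L22 L31 L32 L33 Q31 Q32 Q33 b B2 B3 ->
  L33 \in unitmx -> Q33 \in unitmx -> arnoldi A b s0 V ->
  regular_at t s0 -> regular_at t_r s0 ->
  (forall z, pencil t z \in unitmx -> G z = transfer t z) ->
  match_moments r G (transfer t_r) s0.
Proof.
move=> t_r tP UL UQ [VV /eqmxP kry] reg_t reg_r GE.
have rP := galerkin_normal_form VV tP; rewrite -/t_r in rP.
apply: (match_momentsP (normal_form_momentsP tP UL UQ reg_t GE)
  (normal_form_momentsP rP UL UQ reg_r (fun _ _ => erefl))).
move=> j jr.
have span i : (i < r)%N ->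
   exists w, (if s0 is Some z0 then invmx (z0%:M - cmx A) ^+ i.+1 *m cmx b
          else cmx A ^+ i *m cmx b) = cmx V *m w.
  move=> ir; have := krylov_sub (cmx A) (cmx b) s0 ir.
  rewrite -kry => /submxP[w e]; exists w^T; apply: trmx_inj.
  by rewrite e trmx_mul trmxK.
have WV : cmx V^T *m cmx V = 1%:M by rewrite -cmxM VV cmxE map_mx1.
have cV : cmx ((V^T *m b)^T - B3^T *m invmx L33 *m (L31 *m V))
  = cmx (b^T - B3^T *m invmx L33 *m L31) *m cmx V.
  by rewrite -cmxM mulmxBl trmx_mul trmxK !mulmxA.
rewrite /normal_form_moments cV.
case: s0 {kry} span reg_t reg_r => [z0|] /= span reg_t reg_r; last first.
  by rewrite -mulmxA (galerkin_krylov_power WV span) // !cmxM !mulmxA.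
move: reg_t reg_r; rewrite (normal_form_pencil_unit tP) => /and4P[UA _ _ _].
rewrite (normal_form_pencil_unit rP) !cmxM => /and4P[UAr _ _ _].
have e := galerkin_krylov_resolvent WV UA UAr span jr.
by congr (_ + _); rewrite -mulmxA e !mulmxA.
Qed.

Theorem theorem5 (F : realType) (n1 n2 n3 m r : nat)
  (J11 : 'M[F]_(n1, n1)) (J12 : 'M[F]_(n1, n2)) (J13 : 'M[F]_(n1, n3))
  (J21 : 'M[F]_(n2, n1)) (J22 : 'M[F]_(n2, n2)) (J23 : 'M[F]_(n2, n3))
  (J31 : 'M[F]_(n3, n1)) (J32 : 'M[F]_(n3, n2)) (J33 : 'M[F]_(n3, n3))
  (R11 : 'M[F]_(n1, n1)) (R12 : 'M[F]_(n1, n2)) (R13 : 'M[F]_(n1, n3))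
  (R21 : 'M[F]_(n2, n1)) (R22 : 'M[F]_(n2, n2)) (R23 : 'M[F]_(n2, n3))
  (R31 : 'M[F]_(n3, n1)) (R32 : 'M[F]_(n3, n2)) (R33 : 'M[F]_(n3, n3))
  (Q11 : 'M[F]_(n1, n1)) (Q31 : 'M[F]_(n3, n1)) (Q32 : 'M[F]_(n3, n2))
  (Q33 : 'M[F]_(n3, n3))
  (B1 : 'M[F]_(n1, m)) (B2 : 'M[F]_(n2, m)) (B3 : 'M[F]_(n3, m))
  (K : 'M[F]_n1) (s0 : option F[i]) (V : 'M[F]_(n1, r)) :
  let E := block3 (1%:M : 'M[F]_n1) 0 0
                  0 (1%:M : 'M[F]_n2) 0
                  0 0 (0 : 'M[F]_n3) in
  let J := block3 J11 J12 J13 J21 J22 J23 J31 J32 J33 in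
  let R := block3 R11 R12 R13 R21 R22 R23 R31 R32 R33 in
  let Q := block3 Q11 0 0
                  0 (0 : 'M[F]_n2) 0
                  Q31 Q32 Q33 in
  let full := System E J R Q (col3 B1 B2 B3) in
  let red := reduced K V full in
  R^T = R ->
  pHDAE full ->
  J13 - R13 = 0 -> J23 - R23 = 0 ->
  pdmx Q11 ->
  Q33 \in unitmx ->
  regular_pencil full ->
  cholesky Q11 K ->
  (r < n1)%N ->
  arnoldi (K^T *m (J11 - R11) *m K) (K^T *m B1) s0 V ->
  [/\ (forall (x1 : 'cV[F]_n1) (x2 : 'cV[F]_n2) (x3 : 'cV[F]_n3),
         (diag3 n2 n3 V)^T *m ((diag3 n2 n3 K)^T *m col3 x1 x2 x3)
         = col3 (V^T *m K^T *m x1) x2 x3),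
      [/\ sysE red = block3 (1%:M : 'M[F]_r) 0 0
                            0 (1%:M : 'M[F]_n2) 0
                            0 0 (0 : 'M[F]_n3),
          sysJ red - sysR red =
            block3 (V^T *m K^T *m (J11 - R11) *m K *m V)
                     (V^T *m K^T *m (J12 - R12)) (V^T *m K^T *m (J13 - R13))
                   ((J21 - R21) *m K *m V) (J22 - R22) (J23 - R23)
                   ((J31 - R31) *m K *m V) (J32 - R32) (J33 - R33),
          sysQ red = block3 (1%:M : 'M[F]_r) 0 0
                            0 (0 : 'M[F]_n2) 0
                            (Q31 *m (invmx K)^T *m V) Q32 Q33
        & sysB red = col3 (V^T *m K^T *m B1) B2 B3],
      pHDAE red
    & (regular_at full s0 -> regular_at red s0 ->
       match_moments r (transfer full) (transfer red) s0)].
Proof.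
move=> E J R Q full red symR full_pH L13 L23 _ UQ33 regular chol _ arn.
have [VV _] := arn.
have UK := cholesky_unit chol; have [_ _ QK] := chol.
set A := K^T *m (J11 - R11) *m K in arn *; set b := K^T *m B1 in arn *.
pose U : 'M[F]_(n1 + (n2 + n3)) := diag3 n2 n3 K.
have UU : U \in unitmx by rewrite /U /diag3 unitmx_block3 UK !unitmx1.
have invU : invmx U = diag3 n2 n3 (invmx K) by exact: invmx_diag3.
pose tfull := transform U full.
have tfullP : normal_form tfull A (K^T *m (J12 - R12)) ((J21 - R21) *m K)
   (J22 - R22) ((J31 - R31) *m K) (J32 - R32) (J33 - R33)
   (Q31 *m (invmx K)^T) Q32 Q33 b B2 B3.
  split; rewrite /= ?invU.
  - rewrite /U /diag3 !tr_block3 !mul_block3 !trmx0 !trmx1.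
    rewrite !(mulmx0, mulmx1, mul0mx, mul1mx, addr0, add0r).
    by rewrite -trmx_mul mulVmx // trmx1.
  - rewrite -mulmxBl -mulmxBr sub_block3 L13 L23.
    rewrite /U /diag3 !tr_block3 !mul_block3 !trmx0 !trmx1.
    by rewrite !(mulmx0, mulmx1, mul0mx, mul1mx, addr0, add0r).
  - rewrite /U /diag3 !tr_block3 !mul_block3 !trmx0 !trmx1.
    rewrite !(mulmx0, mulmx1, mul0mx, mul1mx, addr0, add0r).
    by rewrite QK mulKmx // -trmx_mul mulVmx // trmx1.
  - rewrite /U /diag3 tr_block3 mul_block3_col !trmx0 !trmx1.
    by rewrite !(mulmx0, mulmx1, mul0mx, mul1mx, addr0, add0r).
have redP := galerkin_normal_form VV tfullP.
have UL33 : J33 - R33 \in unitmx.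
  have [z] := regular; rewrite -unitfE -unitmxE -(pencil_transform_unit _ _ UU).
  by rewrite (normal_form_pencil_unit tfullP) => /and4P[].
split.
- move=> x1 x2 x3; rewrite /diag3 !tr_block3 !mul_block3_col !trmx0 !trmx1.
  by rewrite !(mulmx0, mulmx1, mul0mx, mul1mx, addr0, add0r) mulmxA.
- have [-> -> -> ->] := redP; split=> //.
  + by rewrite L13 L23 mulmx0 /A !mulmxA.
  + by rewrite /b mulmxA.
- have [_ _ tQ _] := tfullP; have [_ _ rQ _] := redP.
  (* The energy block of [tfull] is the identity, so its [Q] maps the range of
     [diag(V, I, I)] into itself. *)
  apply: pHDAE_galerkin; last exact: pHDAE_transform.
  rewrite -[X in _ = _ *m X]/(sysQ red) rQ tQ.
  rewrite /diag3 !mul_block3.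
  by rewrite !(mulmx0, mulmx1, mul0mx, mul1mx, addr0, add0r).
move=> reg_full reg_red.
have reg_tfull : regular_at tfull s0.
  by case: (s0) reg_full => [z0 /=|//]; rewrite pencil_transform_unit.
apply: (normal_form_match_moments tfullP UL33 UQ33 arn reg_tfull reg_red) => z.
by rewrite pencil_transform_unit // => ?; rewrite transfer_transform.
Qed.
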